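(* Let $1<r<p<\infty$, let $(X,\mu)$ be a probability space, and let $(w_t)_{t\in\mathbb N}$ be a sequence of positive real numbers such that $\|w\|_{p,\infty}<\infty$. For each $t\in\mathbb N$, let $A_t$ be an $L^r$-$L^\infty$ contraction on $(X,\mu)$. Then for any $f\in L^p(X,\mu)$, $$\lim_{t\to\infty}w_tA_tf(x)=0$$ for almost every $x$. In particular, if for each $t\in\mathbb N$ the set $\mathcal T_t$ contains at most $2^t$ measure-preserving transformations of $(X,\mu)$, then for every $f\in L^p(X,\mu)$, $$\lim_{t\to\infty}w_t2^{-t}\sum_{T\in\mathcal T_t}f(Tx)=0$$ for almost every $x$.
   Context: For a sequence $w=(w_t)_{t\in\mathbb N}$ of positive reals, $\|w\|_{p,\infty}=\sup_{y>0}y\cdot|\{t: w_t\ge y\}|^{1/p}$. An $L^r$-$L^\infty$ contraction is a linear operator that is a contraction on both $L^r(X,\mu)$ and $L^\infty(X,\mu)$. *)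

(* Defs.v *)
From HB Require Import structures.
From mathcomp Require Import all_boot all_order all_algebra.
From mathcomp Require Import all_classical all_reals all_analysis.

Set Implicit Arguments.
Unset Strict Implicit.
Unset Printing Implicit Defensive.

Import Order.TTheory GRing.Theory Num.Theory.
Import numFieldNormedType.Exports.

Local Open Scope classical_set_scope.
Local Open Scope ring_scope.

(* [counting] is +oo on infinite sets, and [+oo `^ p^-1 = +oo] for p > 0. *)
Definition weak_lp_norm (R : realType) (p : R) (w : nat -> R) : \bar R :=
  ereal_sup [set (y%:E * counting [set t : nat | (y <= w t)%R] `^ p^-1)%E
            | y in [set y : R | 0 < y]].

(* An operator on L^r(mu) is given by its action on representatives, all
   identities being required up to mu-null sets only; [contraction_ae] says
   that A descends to almost-everywhere classes.  For a probability mu,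
   L^oo(mu) is contained in L^r(mu). *)
Record Lr_Loo_contraction d (X : measurableType d) (R : realType)
    (mu : {measure set X -> \bar R}) (r : R)
    (A : (X -> R) -> (X -> R)) : Prop := LrLooContraction {
  contraction_Lfun : forall f, f \in Lfun mu r%:E -> A f \in Lfun mu r%:E;
  contraction_ae : forall f g,
    f \in Lfun mu r%:E -> g \in Lfun mu r%:E ->
    (\forall x \ae mu, f x = g x) -> \forall x \ae mu, A f x = A g x;
  contraction_linear : forall (a : R) f g,
    f \in Lfun mu r%:E -> g \in Lfun mu r%:E ->
    \forall x \ae mu, A (fun z => a * f z + g z) x = a * A f x + A g x;
  contraction_Lr : forall f, f \in Lfun mu r%:E ->
    ('N[mu]_(r%:E) [EFin \o A f] <= 'N[mu]_(r%:E) [EFin \o f])%E;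
  contraction_Loo : forall f, f \in Lfun mu +oo%E ->
    ('N[mu]_(+oo) [EFin \o A f] <= 'N[mu]_(+oo) [EFin \o f])%E
}.

Definition measure_preserving d (X : measurableType d) (R : realType)
    (mu : {measure set X -> \bar R}) (T : X -> X) : Prop :=
  measurable_fun [set: X] T /\
  forall B : set X, measurable B -> mu (T @^-1` B) = mu B.

(* Main.v *)
Require Import Defs.
From HB Require Import structures.
From mathcomp Require Import all_boot all_order all_algebra.
From mathcomp Require Import all_classical all_reals all_analysis.
From mathcomp Require Import measurable_realfun ess_sup_inf.
From mathcomp Require Import ring.

Set Implicit Arguments.
Unset Strict Implicit.
Unset Printing Implicit Defensive.

Import Order.TTheory GRing.Theory Num.Theory.
Import numFieldNormedType.Exports.

Local Open Scope classical_set_scope.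
Local Open Scope ring_scope.

(** The argument truncates f at a level that depends on t.  Fix e > 0 and split
    f = g_t + h_t, where h_t keeps the values of f with w_t |f| > e and is 0
    elsewhere.  Then |g_t| <= e / w_t, so the L^oo contraction property alone
    gives |w_t A_t g_t| <= e almost everywhere, for all t at once.  For the
    large parts, the L^r contraction property gives

      sum_t int |w_t A_t h_t|^r <= int sum_t (w_t |h_t|)^r,

    and at a point x the inner sum runs over the t with w_t > e / |f x|.  The
    weak l^p hypothesis says that #{t : w_t >= y} = O(y^-p); since r < p, this
    makes sum_(t : w_t >= y) w_t^r = O(y^(r - p)) ([weak_lp_tail_sum]), so the
    inner sum is O(|f x|^r (e / |f x|)^(r - p)) = O(|f x|^p)
    ([sum_excess_le]), which is integrable.  Hence sum_t |w_t A_t h_t|^r is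
    finite almost everywhere and w_t A_t h_t tends to 0
    ([ae_cvg0_sum_integral]).  Letting e run through a sequence tending to 0
    gives the first claim ([contraction_weighted_cvg0]).

    For the second claim, composition with a measure-preserving map does not
    increase L^q norms, so by Minkowski's inequality 2^-t times a sum of at most
    2^t such compositions is a contraction on L^r and on L^oo
    ([average_contraction]), and the first claim applies. *)

(** * Weak l^p sequences *)

Lemma weak_lp_count (R : realType) (p : R) (w : nat -> R) : 0 < p ->
  (weak_lp_norm p w < +oo)%E ->
  exists2 C : R, 0 <= C & forall (y : R) (n : nat), 0 < y ->
    \sum_(t < n | y <= w t) (1 : R) <= C * y `^ (- p).
Proof.
move=> p0 wp.
have ub (y : R) : 0 < y -> (y%:E * counting [set t : nat | (y <= w t)%R] `^ p^-1
    <= weak_lp_norm p w)%E.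
  by move=> y0; apply: ereal_sup_ubound; exists y.
have w0 : (0 <= weak_lp_norm p w)%E.
  apply: le_trans (ub 1 ltr01); apply: mule_ge0 => //; exact: poweR_ge0.
have [M M0 wM] : exists2 M : R, 0 <= M & weak_lp_norm p w = M%:E.
  move: w0 wp; case: (weak_lp_norm p w) => // M.
  by rewrite lee_fin => ? _; exists M.
exists (M `^ p); first exact: powR_ge0.
move=> y n y0; set N := \sum_(_ < _ | _) _.
have N0 : 0 <= N by apply: sumr_ge0.
have Ncount : (N%:E <= counting [set t : nat | (y <= w t)%R])%E.
  rewrite counting_dirac.
  apply: le_trans (nneseries_lim_ge n _); last by move=> *; exact: measure_ge0.
  rewrite big_mkord /N -sumEFin big_mkcond/=.
  apply: lee_sum => i _; rewrite diracE.
  case: ifP => h; last by rewrite lee_fin ler0n.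
  by rewrite (mem_set (_ : [set t | y <= w t] i)).

have yN : y * N `^ p^-1 <= M.
  rewrite -lee_fin -wM; apply: le_trans (ub y y0).
  rewrite EFinM -poweR_EFin lee_pmul2l// ?lte_fin//.
  have mem0y (z : \bar R) : (0 <= z)%E -> z \in `[0%E, +oo%E].
    by move=> z0; rewrite in_itv/= z0 leey.
  apply: gt0_ler_poweR => //; first by rewrite invr_ge0 ltW.
    by apply: mem0y; rewrite lee_fin.
  by apply: mem0y; exact: measure_ge0.
have -> : N = (N `^ p^-1) `^ p by rewrite -powRrM mulVf ?gt_eqF// powRr1.
have -> : y `^ (- p) = (y^-1) `^ p.
  by rewrite -powR_inv1 ?ltW// -powRrM mulN1r.
have yV0 : 0 <= y^-1 by rewrite invr_ge0 ltW.
rewrite -powRM//.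
apply: (@ge0_ler_powR _ p); rewrite ?nnegrE ?powR_ge0 ?mulr_ge0//.
  exact: ltW.
by rewrite ler_pdivlMr// mulrC.
Qed.

(** Let S(y) be the sum on the left.  The terms with y <= w_t < 2y number
    O(y^-p) and are at most (2y)^r each, so S(y) <= S(2y) + O(y^(r - p)).
    Since 2^(r - p) < 1, the bound K y^(r - p) reproduces itself along this
    recursion, and S(y) is an empty sum once y exceeds the finitely many
    w_t with t < n. *)
Lemma weak_lp_tail_sum (R : realType) (r p : R) (w : nat -> R) :
  0 < r -> r < p -> (forall t, 0 < w t) ->
  (weak_lp_norm p w < +oo)%E ->
  exists2 K : R, 0 <= K & forall (y : R) (n : nat), 0 < y ->
    \sum_(t < n | y <= w t) w t `^ r <= K * y `^ (r - p).
Proof.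
move=> r0 rp w0 wp.
have [C C0 count] := weak_lp_count (lt_trans r0 rp) wp.
set q := (2 : R) `^ (r - p).
have q1 : q < 1.
  rewrite /q -opprB powRN invf_lt1 ?powR_gt0//.
  suff : (1 : R) `^ (p - r) < 2 `^ (p - r) by rewrite powR1.
  by apply: gt0_ltr_powR; rewrite ?subr_gt0 ?nnegrE ?ltr1n ?ler01.
(* The solution of K * q + 2 ^ r * C = K, the fixed point of the recursion. *)
set K := 2 `^ r * C / (1 - q).
have K0 : 0 <= K.
  by apply: divr_ge0; [rewrite mulr_ge0 ?powR_ge0 | rewrite subr_ge0 ltW].
exists K => // y n y0.
(* The number of doublings of y after which the sum is empty; it depends on n
   and y, but the constant K does not. *)
have [k wk] : exists k, forall t : 'I_n, w t < 2 ^+ k * y.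
  set W := \sum_(t < n) w t.
  have [k Wk] : exists k : nat, W / y < k%:R.
    exists (Num.bound (W / y)); apply: archi_boundP.
    by rewrite divr_ge0 ?(ltW y0)//; apply: sumr_ge0 => t _; exact: ltW.
  exists k => t; rewrite -ltr_pdivrMr//.
  apply: le_lt_trans (_ : W / y < _); last first.
    by apply: lt_le_trans Wk _; rewrite -natrX ler_nat ltnW// ltn_expl.
  rewrite ler_pM2r ?invr_gt0// /W (bigD1 t)//= lerDl.
  by apply: sumr_ge0 => ? _; exact: ltW.
elim: k y y0 wk => [|k IH] y y0 wk.
  have K0y := mulr_ge0 K0 (powR_ge0 y (r - p)).
  rewrite big_pred0// => t.
  by apply/negbTE; rewrite -ltNge -[y]mul1r -(expr0 2) wk.
have y20 : 0 < 2 * y by rewrite mulr_gt0.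
have {}IH : \sum_(t < n | 2 * y <= w t) w t `^ r <= K * (2 * y) `^ (r - p).
  by apply: IH => // t; rewrite mulrA -exprSr.
rewrite (bigID (fun t : 'I_n => 2 * y <= w t))/=.
rewrite (eq_bigl (fun t : 'I_n => 2 * y <= w t)); last first.
  move=> t; apply/andb_idl => /(le_trans _); apply.
  by rewrite ler_peMl ?(ltW y0)// ler1n.
apply: (@le_trans _ _
    (K * (2 * y) `^ (r - p) + (2 * y) `^ r * (C * y `^ (- p)))).
  apply: lerD => //.
  apply: le_trans (ler_wpM2l (powR_ge0 _ _) (count y n y0)).
  rewrite mulr_sumr [leRHS](bigID (fun t : 'I_n => 2 * y <= w t))/=.
  rewrite ler_wpDl//.
    by apply: sumr_ge0 => *; rewrite mulr1 powR_ge0.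
  apply: ler_sum => t /andP[_]; rewrite -ltNge mulr1 => wty.
  by apply: ge0_ler_powR; rewrite ?nnegrE; exact/ltW.
rewrite !powRM ?(ltW y0)// -/q.
have -> : 2 `^ r * y `^ r * (C * y `^ (- p)) = 2 `^ r * C * y `^ (r - p).
  have yn0 : y != 0 by rewrite gt_eqF.
  by rewrite powRD ?yn0 ?implybT// mulrACA.
rewrite mulrA -mulrDl ler_wpM2r ?powR_ge0//.
have -> : 2 `^ r * C = K * (1 - q) by rewrite divfK// subr_eq0 gt_eqF.
by rewrite -mulrDr subrKC mulr1.
Qed.

(** * Almost everywhere convergence from summable integrals *)

Lemma nneseries_le_bound (R : realType) (u : nat -> \bar R) (M : \bar R) :
  (forall n, (0 <= u n)%E) -> (forall n, (\sum_(t < n) u t <= M)%E) ->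
  (\sum_(0 <= t <oo) u t <= M)%E.
Proof.
move=> u0 uM; apply: lime_le; first by apply: is_cvg_nneseries.
by apply: nearW => n; rewrite big_mkord.
Qed.

(** The series of the F_t has a finite integral, hence finite values almost
    everywhere, and the terms of a convergent series tend to 0. *)
Lemma ae_cvg0_sum_integral d (X : measurableType d) (R : realType)
    (mu : {measure set X -> \bar R}) (F : nat -> X -> R) (M : R) :
  (forall t, measurable_fun [set: X] (F t)) ->
  (forall t x, 0 <= F t x) ->
  (forall n, (\sum_(t < n) \int[mu]_x (F t x)%:E <= M%:E)%E) ->
  \forall x \ae mu, F ^~ x @ \oo --> (0 : R).
Proof.
move=> mF F0 FM.
pose S x := (\sum_(0 <= t <oo) (F t x)%:E)%E.
have mFE t : measurable_fun [set: X] (EFin \o F t).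
  exact/measurable_EFinP.
have S0 x : (0 <= S x)%E by apply: nneseries_ge0 => t _ _; rewrite lee_fin.
have iS : mu.-integrable [set: X] S.
  apply/integrableP; split.
    apply: (ge0_emeasurable_sum (P := xpredT)) => [t x _ _|t _] //.
      by rewrite lee_fin.
    exact: mFE.
  under eq_integral do rewrite gee0_abs//.
  rewrite /S integral_nneseries//; last by move=> t x _; rewrite lee_fin.
  apply: (@le_lt_trans _ _ M%:E); last exact: ltry.
  apply: nneseries_le_bound => // t.
  by apply: integral_ge0 => x _; rewrite lee_fin.
have := integrable_ae measurableT iS.
apply: filterS => x /(_ I) Sx.
apply: cvg_series_cvg_0; apply: nnseries_is_cvg => //.
by rewrite ltey_eq Sx.
Qed.

(** * Values above a threshold *)

Definition excess (R : realType) (c v : R) : R := if c < `|v| then v else 0.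

(** For v <> 0 only the t with w_t > e / |v| contribute, so the tail bound at
    y = e / |v| applies; the factor |v|^r turns |v|^(p - r) into |v|^p. *)
Lemma sum_excess_le (R : realType) (r p e : R) (w : nat -> R) :
  0 < r -> r < p -> 0 < e -> (forall t, 0 < w t) ->
  (weak_lp_norm p w < +oo)%E ->
  exists2 K : R, 0 <= K & forall (v : R) (n : nat),
    \sum_(t < n) (w t * `|excess (e / w t) v|) `^ r <= K * `|v| `^ p.
Proof.
move=> r0 rp e0 w0 wp.
have [K K0 tail] := weak_lp_tail_sum r0 rp w0 wp.
exists (K * e `^ (r - p)); first by rewrite mulr_ge0 ?powR_ge0.
move=> v n; have [->|v0] := eqVneq v 0.
  rewrite big1 ?mulr_ge0 ?powR_ge0// => t _.
  by rewrite /excess if_same normr0 mulr0 powR0 ?gt_eqF.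
have nv0 : 0 < `|v| by rewrite normr_gt0.
have y0 : 0 < e / `|v| by rewrite divr_gt0.
apply: (@le_trans _ _ (`|v| `^ r * \sum_(t < n | e / `|v| <= w t) w t `^ r)).
  rewrite mulr_sumr [leRHS]big_mkcond/=; apply: ler_sum => t _.
  have -> : (w t * `|excess (e / w t) v|) `^ r =
            if e / w t < `|v| then `|v| `^ r * w t `^ r else 0.
    rewrite /excess; case: ifP => _; last by rewrite normr0 mulr0 powR0 ?gt_eqF.
    by rewrite powRM ?(ltW (w0 t))// mulrC.
  case: ifPn => [|_]; last by case: ifP => // _; rewrite mulr_ge0 ?powR_ge0.
  rewrite ltr_pdivrMr// mulrC => /ltW ewv.
  by rewrite ifT// ler_pdivrMr.
apply: le_trans (ler_wpM2l (powR_ge0 _ _) (tail _ n y0)) _.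
rewrite powRM ?invr_ge0// ?(ltW e0)//.
have -> : `|v|^-1 `^ (r - p) = `|v| `^ (p - r).
  by rewrite -powR_inv1// -powRrM mulN1r opprB.
have -> : `|v| `^ p = `|v| `^ r * `|v| `^ (p - r).
  by rewrite -powRD ?subrKC// (gt_eqF nv0) implybT.
by rewrite le_eqVlt; apply/orP; left; apply/eqP; ring.
Qed.

(** * Contractions on L^r and L^oo *)

Lemma Lfun_measurable d (X : measurableType d) (R : realType)
    (mu : {measure set X -> \bar R}) (q : \bar R) (f : X -> R) :
  f \in Lfun mu q -> measurable_fun [set: X] f.
Proof. by rewrite inE => /andP[+ _]; rewrite inE. Qed.

Lemma Lnorm_oo d (X : measurableType d) (R : realType)
    (mu : probability X R) (f : X -> R) :
  'N[mu]_(+oo)[EFin \o f]%E = ess_sup mu (fun x => `|f x|%:E).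
Proof.
have mu0 : (0 < mu [set: X])%E by rewrite probability_setT lte01.
rewrite unlock; case: ifPn => // /negP []; exact: mu0.
Qed.

Lemma Lfun_oo_bounded d (X : measurableType d) (R : realType)
    (mu : probability X R) (f : X -> R) (c : R) :
  measurable_fun [set: X] f -> (forall x, `|f x| <= c) -> f \in Lfun mu +oo%E.
Proof.
move=> mf fc; rewrite inE; apply/andP; split; rewrite inE//=.
rewrite /finite_norm Lnorm_oo; apply: (@le_lt_trans _ _ c%:E); last exact: ltry.
by apply/ess_supP; apply: nearW => x; rewrite lee_fin.
Qed.

Lemma contraction_bounded d (X : measurableType d) (R : realType)
    (mu : probability X R) (r : R) (A : (X -> R) -> (X -> R)) (g : X -> R)
    (c : R) :
  Lr_Loo_contraction mu r A -> measurable_fun [set: X] g ->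
  (forall x, `|g x| <= c) -> \forall x \ae mu, `|A g x| <= c.
Proof.
move=> cA mg gc.
have /(contraction_Loo cA) : g \in Lfun mu +oo%E by exact: Lfun_oo_bounded gc.
rewrite !Lnorm_oo => Agg.
have : (ess_sup mu (fun x => `|A g x|%:E) <= c%:E)%E.
  apply: le_trans Agg _.
  by apply/ess_supP; apply: nearW => x; rewrite lee_fin.
by move/ess_supP; apply: filterS => x; rewrite lee_fin.
Qed.

Lemma contraction_integral_powR d (X : measurableType d) (R : realType)
    (mu : {measure set X -> \bar R}) (r : R) (A : (X -> R) -> (X -> R))
    (h : X -> R) : 0 < r ->
  Lr_Loo_contraction mu r A -> h \in Lfun mu r%:E ->
  (\int[mu]_x (`|A h x| `^ r)%:E <= \int[mu]_x (`|h x| `^ r)%:E)%E.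
Proof.
move=> r0 cA hr.
have NE f : (\int[mu]_x (`|f x| `^ r)%:E = 'N[mu]_(r%:E)[EFin \o f] `^ r)%E.
  by rewrite poweR_Lnorm ?gt_eqF//.
rewrite !NE; apply: gt0_ler_poweR; first exact: ltW.
- by rewrite in_itv/= Lnorm_ge0 leey.
- by rewrite in_itv/= Lnorm_ge0 leey.
- exact: contraction_Lr.
Qed.

Lemma measurable_excess d (X : measurableType d) (R : realType) (c : R)
    (f : X -> R) : measurable_fun [set: X] f ->
  measurable_fun [set: X] (excess c \o f).
Proof.
move=> mf; apply: measurable_fun_ifT => //.
by apply: measurable_fun_ltr => //; exact: measurableT_comp.
Qed.

(** Truncation at the level (e / 2) / w_t: the bounded part contributes at most
    e / 2 for every t, the excess part tends to 0. *)
Lemma contraction_weighted_cvg0 d (X : measurableType d) (R : realType)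
    (mu : probability X R) (r p : R) (w : nat -> R)
    (A : nat -> (X -> R) -> (X -> R)) (f : X -> R) :
  1 < r -> r < p -> (forall t, 0 < w t) -> (weak_lp_norm p w < +oo)%E ->
  (forall t, Lr_Loo_contraction mu r (A t)) -> f \in Lfun mu p%:E ->
  \forall x \ae mu, (fun t : nat => w t * A t f x) @ \oo --> (0 : R).
Proof.
move=> r1 rp w0 wp cA fp.
have r0 : 0 < r by exact: lt_trans r1.
have p1 : 1 < p by exact: lt_trans rp.
have mf := Lfun_measurable fp.
have fr : f \in Lfun mu r%:E.
  apply: Lfun_subset fp; rewrite ?lee_fin ?(ltW r1) ?(ltW p1) ?(ltW rp)//.
  exact: fin_num_measure.
(* The truncation depends on e, so each e has its own null set; the countably
   many values e = 1 / (k + 1) suffice. *)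
suff small (e : R) : 0 < e ->
    \forall x \ae mu, \forall t \near \oo, `|w t * A t f x| <= e.
  have : \forall x \ae mu, forall k : nat,
      \forall t \near \oo, `|w t * A t f x| <= k.+1%:R^-1.
    by apply: ae_foralln => k; apply: small; rewrite invr_gt0.
  apply: filterS => x xk; apply/cvgrPdist_le => e e0.
  have [k ke] : exists k : nat, k.+1%:R^-1 <= e.
    exists (Num.bound e^-1); rewrite invf_ple ?posrE//.
    apply/ltW/(lt_le_trans (archi_boundP _)); first by rewrite invr_ge0 ltW.
    by rewrite ler_nat.
  have := xk k; apply: filterS => t wt.
  by rewrite sub0r normrN; exact: le_trans wt ke.
move=> e0; have e20 : 0 < e / 2 by rewrite divr_gt0.
pose c t := e / 2 / w t.
pose h t := excess (c t) \o f.
pose g t x := f x - h t x.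
have mh t : measurable_fun [set: X] (h t) by exact: measurable_excess.
have mg t : measurable_fun [set: X] (g t) by exact: measurable_funB.
have gc t x : `|g t x| <= c t.
  rewrite /g /h /= /excess; case: ltP => [_|]; last by rewrite subr0.
  by rewrite subrr normr0 divr_ge0// ltW.
have gr t : g t \in Lfun mu r%:E.
  apply: (Lfun_subset (q := +oo%E)); rewrite ?lee_fin ?(ltW r1) ?leey//.
    exact: fin_num_measure.
  exact: Lfun_oo_bounded (gc t).
have r1E : (1 <= r%:E)%E by rewrite lee_fin ltW.
have hr t : h t \in Lfun mu r%:E.
  have -> : h t = f - g t by apply/funext => x; rewrite /g /= !fctE subKr.
  by rewrite rpredB.
have [K K0 hK] := sum_excess_le r0 rp e20 w0 wp.
(* Summability of the excess parts in L^r. *)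
pose F t x := (w t * `|A t (h t) x|) `^ r.
have FE t x : (F t x)%:E = ((w t `^ r)%:E * (`|A t (h t) x| `^ r)%:E)%E.
  by rewrite /F powRM// ltW.
have mpow (k : X -> R) : measurable_fun [set: X] k ->
    measurable_fun [set: X] (EFin \o (fun x => `|k x| `^ r)).
  move=> mk; apply/measurable_EFinP.
  apply: (measurableT_comp (measurable_powR _)) => //.
  exact: measurableT_comp.
have mAh t : measurable_fun [set: X] (A t (h t)).
  by apply: (Lfun_measurable (q := r%:E)); exact: contraction_Lfun.
have F0 : \forall x \ae mu, F ^~ x @ \oo --> (0 : R).
  pose M := (\int[mu]_x (K * `|f x| `^ p)%:E)%E.
  have M0 : (0 <= M)%E.
    by apply: integral_ge0 => x _; rewrite lee_fin mulr_ge0 ?powR_ge0.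
  have ifp := Lfun_integrable (ltW p1) fp.
  have Moo : (M < +oo)%E.
    apply: integrable_lty => //; rewrite /M.
    exact: (integrableZl measurableT K ifp).
  apply: (@ae_cvg0_sum_integral _ _ _ _ _ (fine M)) => [t|t x|n].
  - apply: (measurableT_comp (measurable_powR _)) => //.
    by apply: measurable_funM => //; exact: measurableT_comp.
  - exact: powR_ge0.
  rewrite fineK ?ge0_fin_numE//.
  have Fh t : (\int[mu]_x (F t x)%:E <=
      \int[mu]_x ((w t * `|h t x|) `^ r)%:E)%E.
    under eq_integral do rewrite FE.
    under [leRHS]eq_integral do rewrite powRM ?(ltW (w0 t))// EFinM.
    rewrite !ge0_integralZl ?lee_fin ?powR_ge0//; try exact: mpow.
    rewrite lee_pmul2l ?lte_fin ?powR_gt0//.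
    exact: contraction_integral_powR.
  have mwh t :
      measurable_fun [set: X] (EFin \o (fun x => (w t * `|h t x|) `^ r)).
    apply/measurable_EFinP; apply: (measurableT_comp (measurable_powR _)) => //.
    by apply: measurable_funM => //; exact: measurableT_comp.
  apply: (@le_trans _ _
      (\sum_(t < n) \int[mu]_x ((w t * `|h t x|) `^ r)%:E)%E).
    by apply: lee_sum => t _; exact: Fh.
  rewrite -ge0_integral_sum//; last 2 first.
  - exact: mwh.
  - by move=> t x _; rewrite lee_fin powR_ge0.
  apply: ge0_le_integral => //.
  - by move=> x _; rewrite sume_ge0// => t _; rewrite lee_fin powR_ge0.
  - by apply: emeasurable_sum => t; exact: mwh.
  - apply/measurable_EFinP/measurable_funM => //.
    exact/measurable_EFinP/measurable_int/ifp.
  - by move=> x _; rewrite sumEFin lee_fin; exact: hK.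
have decomp : \forall x \ae mu, forall t, A t f x = A t (h t) x + A t (g t) x.
  apply: ae_foralln => t.
  have := contraction_linear (cA t) 1 (hr t) (gr t).
  apply: filterS => x; rewrite mul1r => <-.
  by congr (A t _ x); apply/funext => z; rewrite mul1r /g subrKC.
have gsmall : \forall x \ae mu, forall t, `|A t (g t) x| <= c t.
  by apply: ae_foralln => t; exact: contraction_bounded (gc t).
near=> x.
have Fx : F ^~ x @ \oo --> (0 : R) by near: x.
have gx : forall t, `|A t (g t) x| <= c t by near: x.
have dx : forall t, A t f x = A t (h t) x + A t (g t) x by near: x.
(* F ^~ x tends to 0 as an r-th power; undo the power by monotonicity. *)
have e2r : 0 < (e / 2) `^ r by rewrite powR_gt0.
move/cvgrPdist_lt : Fx => /(_ _ e2r); apply: filterS => t.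
rewrite sub0r normrN ger0_norm ?powR_ge0// => Ft.
have wh : w t * `|A t (h t) x| <= e / 2.
  rewrite leNgt; apply/negP => wh.
  have : (e / 2) `^ r <= F t x.
    by apply: ge0_ler_powR; rewrite ?nnegrE ?mulr_ge0// ltW.
  by rewrite leNgt Ft.
have wg : w t * `|A t (g t) x| <= e / 2.
  by rewrite mulrC -ler_pdivlMr.
rewrite normrM (ger0_norm (ltW (w0 t))) dx.
apply: le_trans (ler_wpM2l (ltW (w0 t)) (ler_normD _ _)) _.
by rewrite mulrDr [leRHS]splitr lerD.
Unshelve. all: by end_near.
Qed.

(** * Averages over measure-preserving maps *)

Lemma measure_preserving_ae d (X : measurableType d) (R : realType)
    (mu : {measure set X -> \bar R}) (T : X -> X) (P : X -> Prop) :
  measure_preserving mu T -> (\forall x \ae mu, P x) ->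
  \forall x \ae mu, P (T x).
Proof.
move=> [mT muT] [N [mN N0 PN]]; exists (T @^-1` N); split.
- by rewrite -[_ @^-1` _]setTI; exact: mT.
- by rewrite muT.
- by move=> x /= nP; exact: PN.
Qed.

(** For finite q the integral is invariant under T; for q = +oo an almost
    everywhere bound on f pulls back along T. *)
Lemma Lnorm_comp_le d (X : measurableType d) (R : realType)
    (mu : probability X R) (q : \bar R) (T : X -> X) (f : X -> R) :
  (1 <= q)%E -> measure_preserving mu T -> measurable_fun [set: X] f ->
  ('N[mu]_q[EFin \o (f \o T)] <= 'N[mu]_q[EFin \o f])%E.
Proof.
move=> q1 mpT mf; have [mT muT] := mpT.
case: q q1 => [r r1||//].
  rewrite unlock/= le_eqVlt; apply/orP; left; apply/eqP; congr (_ `^ _)%E.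
  have mfr : measurable_fun [set: X] (EFin \o (fun x => `|f x| `^ r)).
    apply/measurable_EFinP; apply: (measurableT_comp (measurable_powR _)) => //.
    exact: measurableT_comp.
  have := @ge0_integral_pushforward _ _ _ _ _ _ mT mu _ _ measurableT mfr.
  rewrite preimage_setT => <-.
    by apply: eq_measure_integral => B mB _; exact: muT.
  by move=> x _; rewrite lee_fin powR_ge0.
rewrite !Lnorm_oo => _; apply/ess_supP.
exact: measure_preserving_ae mpT (ess_sup_ge _ _).
Qed.

Lemma Lfun_comp d (X : measurableType d) (R : realType)
    (mu : probability X R) (q : \bar R) (T : X -> X) (f : X -> R) :
  (1 <= q)%E -> measure_preserving mu T -> f \in Lfun mu q ->
  f \o T \in Lfun mu q.
Proof.
move=> q1 mpT fq; have mf := Lfun_measurable fq; have [mT _] := mpT.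
rewrite inE; apply/andP; split; rewrite inE/=.
  exact: measurableT_comp.
apply: le_lt_trans (Lnorm_comp_le q1 mpT mf) _.
by move: fq; rewrite inE => /andP[_]; rewrite inE.
Qed.

Lemma Lfun_sum_comp d (X : measurableType d) (R : realType)
    (mu : probability X R) (q : \bar R) (s : seq (X -> X)) (f : X -> R) :
  (1 <= q)%E -> {in s, forall T, measure_preserving mu T} ->
  f \in Lfun mu q -> (fun x => \sum_(T <- s) f (T x)) \in Lfun mu q.
Proof.
move=> q1 mps fq.
have -> : (fun x => \sum_(T <- s) f (T x)) = \sum_(T <- s) (f \o T).
  by apply/funext => x; rewrite fct_sumE.
by rewrite big_seq rpred_sum// => T Ts; apply: Lfun_comp => //; exact: mps.
Qed.

Lemma Lnorm_sum_comp d (X : measurableType d) (R : realType)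
    (mu : probability X R) (q : \bar R) (s : seq (X -> X)) (f : X -> R) :
  (1 <= q)%E -> {in s, forall T, measure_preserving mu T} ->
  f \in Lfun mu q ->
  ('N[mu]_q[EFin \o (fun x => \sum_(T <- s) f (T x))%R]
    <= (size s)%:R%:E * 'N[mu]_q[EFin \o f])%E.
Proof.
move=> q1 + fq; elim: s => [_|T s IH mps].
  have -> : (fun x => \sum_(T <- ([::] : seq (X -> X))) f (T x)) = cst 0.
    by apply/funext => x; rewrite big_nil.
  by rewrite mul0e Lnorm0// gt_eqF// (lt_le_trans _ q1).
have mpT : measure_preserving mu T by apply: mps; rewrite mem_head.
have {}mps : {in s, forall T, measure_preserving mu T}.
  by move=> U Us; apply: mps; rewrite in_cons Us orbT.
have -> : (fun x => \sum_(T <- T :: s) f (T x)) =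
          (f \o T) \+ (fun x => \sum_(T <- s) f (T x)).
  by apply/funext => x; rewrite big_cons.
have mf := Lfun_measurable fq.
apply: le_trans (eminkowski mu _ _ q1) _.
- exact: Lfun_measurable (Lfun_comp q1 mpT fq).
- exact: Lfun_measurable (Lfun_sum_comp q1 mps fq).
rewrite /= -natr1 EFinD ge0_muleDl ?lee_fin// mul1e [leRHS]addeC.
by apply: leeD; [exact: Lnorm_comp_le | exact: IH].
Qed.

Lemma Lnorm_average_le d (X : measurableType d) (R : realType)
    (mu : probability X R) (q : \bar R) (s : seq (X -> X)) (m : nat)
    (f : X -> R) : (1 <= q)%E -> (0 < m)%N -> (size s <= m)%N ->
  {in s, forall T, measure_preserving mu T} -> f \in Lfun mu q ->
  ('N[mu]_q[EFin \o (fun x => m%:R^-1 * \sum_(T <- s) f (T x))%R]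
    <= 'N[mu]_q[EFin \o f])%E.
Proof.
move=> q1 m0 sm mps fq.
have := LnormZ (Lfun_Sub q1 (Lfun_sum_comp q1 mps fq)) m%:R^-1.
rewrite /= => NZ; rewrite [leLHS]NZ.
have mR0 : (0 : R) < m%:R by rewrite ltr0n.
rewrite ger0_norm ?invr_ge0//.
rewrite lee_pdivrMl//; apply: le_trans (Lnorm_sum_comp q1 mps fq) _.
by apply: lee_wpmul2r; [exact: Lnorm_ge0 | rewrite lee_fin ler_nat].
Qed.

(** The normalization is by an upper bound m of the number of maps, which may
    exceed that number: the sum has norm at most [size s] times that of f. *)
Lemma average_contraction d (X : measurableType d) (R : realType)
    (mu : probability X R) (r : R) (s : seq (X -> X)) (m : nat) :
  1 <= r -> (0 < m)%N -> (size s <= m)%N ->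
  {in s, forall T, measure_preserving mu T} ->
  Lr_Loo_contraction mu r (fun f x => m%:R^-1 * \sum_(T <- s) f (T x)).
Proof.
move=> r1 m0 sm mps; have r1E : (1 <= r%:E)%E by rewrite lee_fin.
split=> [f fr|f g fr gr fg|a f g fr gr|f fr|f fo].
- rewrite (_ : (fun x => _) = m%:R^-1 *: (fun x => \sum_(T <- s) f (T x)))//.
  by rewrite rpredZ// Lfun_sum_comp.
- have : \forall x \ae mu, {in s, forall T, f (T x) = g (T x)}.
    elim: s mps {sm} => [_|T s IH mps]; first exact: nearW.
    have fgT := measure_preserving_ae (mps _ (mem_head T s)) fg.
    have {IH} : \forall x \ae mu, {in s, forall T, f (T x) = g (T x)}.
      by apply: IH => U Us; apply: mps; rewrite in_cons Us orbT.
    apply: filterS2 fgT => x fgx fgs U.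
    by rewrite in_cons => /predU1P[->//|]; exact: fgs.
  apply: filterS => x fgx; congr (_ * _).
  by rewrite big_seq [RHS]big_seq; apply: eq_bigr => T Ts; exact: fgx.
- apply: nearW => x; rewrite big_split/= -mulr_sumr.
  by rewrite mulrDr mulrCA.
- exact: Lnorm_average_le.
- by apply: Lnorm_average_le => //; rewrite leey.
Qed.

(** * The weighted convergence theorem *)

Theorem theorem2p3 (R : realType) (d : measure_display) (X : measurableType d)
    (mu : probability X R) (r p : R) (w : nat -> R)
    (r_gt1 : 1 < r) (r_lt_p : r < p)
    (w_gt0 : forall t, 0 < w t)
    (w_weak : (weak_lp_norm p w < +oo)%E) :
  (forall A : nat -> (X -> R) -> (X -> R),
     (forall t, Lr_Loo_contraction mu r (A t)) ->
     forall f : X -> R, f \in Lfun mu p%:E ->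
     \forall x \ae mu, (fun t : nat => w t * A t f x) @ \oo --> (0 : R))
  /\
  (forall TT : nat -> set (X -> X),
     (forall t, (TT t #<= `I_(2 ^ t))%card) ->
     (forall t T, TT t T -> measure_preserving mu T) ->
     forall f : X -> R, f \in Lfun mu p%:E ->
     \forall x \ae mu,
       (fun t : nat => w t * (2 ^- t * \sum_(T \in TT t) f (T x)))
         @ \oo --> (0 : R)).
Proof.
split=> [A cA f fp|TT cTT mpTT f fp].
  exact: (contraction_weighted_cvg0 r_gt1 r_lt_p w_gt0 w_weak cA fp).
have finTT t : finite_set (TT t).
  by apply: card_le_finite (cTT t) _; exact: finite_II.
pose s t : seq (X -> X) := finmap.enum_fset (fset_set (TT t)).
pose A t (g : X -> R) x := (2 ^ t)%:R^-1 * \sum_(T <- s t) g (T x).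
have cA t : Lr_Loo_contraction mu r (A t).
  apply: average_contraction => //; rewrite ?ltW ?expn_gt0//.
    exact: geq_card_fset_set.
  by move=> T; rewrite in_fset_set// inE => /mpTT.
have := contraction_weighted_cvg0 r_gt1 r_lt_p w_gt0 w_weak cA fp.
apply: filterS => x; rewrite (_ : (fun t : nat => w t * A t f x) =
  (fun t : nat => w t * (2 ^- t * \sum_(T \in TT t) f (T x))))//.
by apply/funext => t; rewrite /A natrX fsbig_finite.
Qed.
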